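(* Let $h(t)$ be a reciprocal polynomial of degree $n$, and let $\gamma(u)=\sum_{r\ge0}\gamma_ru^r$ be the unique polynomial of degree at most $\lfloor n/2\rfloor$ such that $h(t)=(1+t)^n\,\gamma\!\left(\frac{t}{(1+t)^2}\right)$. Let $J(v)=\frac{h(v)}{(1+v)^n}$, regarded as a formal power series in $v$. Then for every integer $r\ge 1$, $$r\,\gamma_r=[u^{r-1}]\;J'(u)\,(u+1)^{2r}.$$
   Context: A polynomial $h$ of degree $n$ (with, say, real coefficients) is reciprocal if $t^nh(1/t)=h(t)$. For such $h$ a unique polynomial $\gamma$ of degree at most $\lfloor n/2\rfloor$ with $h(t)=(1+t)^n\gamma(t/(1+t)^2)$ exists. $[u^a]F(u)$ denotes the coefficient of $u^a$ in the power series $F(u)$, and $J'$ is the formal derivative of $J$. *)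

(* Defs.v *)
From HB Require Import structures.
From mathcomp Require Import all_boot all_order all_algebra.
Set Implicit Arguments.
Unset Strict Implicit.
Unset Printing Implicit Defensive.
Import GRing.Theory.
Local Open Scope ring_scope.

(* Formal power series as coefficient sequences: [u^a] F is F a.              *)
Definition fps (R : nzRingType) := nat -> R.

Section PowerSeries.
Variable R : fieldType.
Implicit Types (f g : fps R) (p : {poly R}).

Definition fps_of_poly p : fps R := fun k => p`_k.

Definition fps_mul f g : fps R := fun k => \sum_(i < k.+1) f i * g (k - i)%N.

Definition fps_deriv f : fps R := fun k => f k.+1 *+ k.+1.

(* First m coefficients of 1/f, by the recursion                              *)
(*   g_m = (delta_{m,0} - \sum_(1 <= i <= m) f_i * g_(m - i)) / f_0           *)
Fixpoint fps_inv_prefix f (m : nat) : seq R :=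
  if m is m'.+1 then
    let s := fps_inv_prefix f m' in
    rcons s (((m' == 0%N)%:R - \sum_(i < m') f i.+1 * s`_(m' - i.+1)) / f 0%N)
  else [::].

(* Meaningful only when the constant coefficient f 0 is nonzero; see          *)
(* fps_mulV.                                                                  *)
Definition fps_inv f : fps R := fun k => (fps_inv_prefix f k.+1)`_k.

Lemma size_fps_inv_prefix f m : size (fps_inv_prefix f m) = m.
Proof. by elim: m => //= m IHm; rewrite size_rcons IHm. Qed.

Lemma nth_fps_inv_prefix f m k :
  (k < m)%N -> (fps_inv_prefix f m)`_k = fps_inv f k.
Proof.
elim: m => // m IHm; rewrite ltnS leq_eqVlt => /orP[/eqP -> // | lt_km].
by rewrite /= nth_rcons size_fps_inv_prefix lt_km IHm.
Qed.

Lemma fps_mulV f k :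
  f 0%N != 0 -> fps_mul f (fps_inv f) k = fps_of_poly 1 k.
Proof.
move=> f0; rewrite /fps_mul /fps_of_poly coef1 big_ord_recl subn0.
rewrite {1}/fps_inv /= nth_rcons size_fps_inv_prefix ltnn eqxx.
rewrite mulrCA mulfV // mulr1.
under [X in _ - X + _]eq_bigr => i _.
  rewrite nth_fps_inv_prefix;
    last by rewrite ltn_subrL (leq_ltn_trans _ (ltn_ord i)).
  over.
by rewrite subrK.
Qed.

End PowerSeries.

(* Identities in t are stated in the rational function field R(t), with t    *)
(* being tofrac 'X, rather than pointwise, since R may be finite.             *)
Definition eval_ratfun (R : fieldType) (p : {poly R}) (x : {fraction {poly R}}) :
  {fraction {poly R}} :=
  (map_poly (@FracField.tofrac {poly R} \o @polyC R) p).[x].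

Definition reciprocal (R : fieldType) (n : nat) (h : {poly R}) : Prop :=
  size h = n.+1 /\
  tofrac 'X ^+ n * eval_ratfun h (tofrac 'X)^-1 = tofrac h.

Definition is_gamma_poly (R : fieldType) (n : nat) (h gamma : {poly R}) : Prop :=
  (size gamma <= n./2.+1)%N /\
  tofrac h = tofrac (1 + 'X) ^+ n
             * eval_ratfun gamma (tofrac 'X / tofrac (1 + 'X) ^+ 2).

Definition J_series (R : fieldType) (n : nat) (h : {poly R}) : fps R :=
  fps_mul (fps_of_poly h) (fps_inv (fps_of_poly ((1 + 'X) ^+ n))).

(* Main.v *)
(* Writing J (1+X)^n = h as J = \sum_j gamma_j (X/(1+X)^2)^j, the product rule
   turns the right-hand side into
     r [u^r] J (1+u)^(2r) - 2r [u^(r-1)] J (1+u)^(2r-1).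
   The j-th summand contributes r gamma_j (C(2m,m) - 2 C(2m-1,m-1)) with
   m = r - j, which vanishes unless m = 0.  All series are replaced by
   polynomials modulo a power of X, where 1+X can be cancelled. *)
Require Import Defs.
From HB Require Import structures.
From mathcomp Require Import all_boot all_order all_algebra.
From mathcomp Require Import ring.
Import GRing.Theory.
Local Open Scope ring_scope.

Lemma eval_ratfunE (R : fieldType) (p : {poly R}) (m : nat) x :
  (size p <= m)%N ->
  eval_ratfun p x = \sum_(i < m) tofrac (p`_i)%:P * x ^+ i.
Proof.
move=> szp; rewrite /eval_ratfun (@horner_coef_wide _ m); last first.
  by apply: leq_trans szp; rewrite /map_poly; apply: size_poly.
by apply: eq_bigr => i _; rewrite coef_map.
Qed.

Lemma addX1_neq0 (R : fieldType) : 'X + 1 != 0 :> {poly R}.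
Proof. by rewrite -size_poly_eq0 size_XaddC. Qed.

(** Guarantees that the truncated subtraction [n - i.*2] is a true difference at every index where
    [gamma] can have a nonzero coefficient. *)
Lemma gamma_poly_double_le (R : fieldType) (n i : nat) (h gamma : {poly R}) :
  is_gamma_poly n h gamma -> (i < size gamma)%N -> (i.*2 <= n)%N.
Proof.
move=> [szg _] lt_i; apply: (@leq_trans n./2.*2).
  by rewrite leq_double -ltnS (leq_trans lt_i).
by rewrite -{2}[n]odd_double_half leq_addl.
Qed.

(** Clears denominators: in the i-th term, the factor (1+X)^(2i) of (1+X)^n cancels the denominator
    of (X/(1+X)^2)^i. The bound [N] is left free so that the sum can later be split at any chosen
    index. *)
Lemma gamma_poly_expansion (R : fieldType) (n N : nat) (h gamma : {poly R}) :
  is_gamma_poly n h gamma -> (n./2 < N)%N ->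
  h = \sum_(i < N) gamma`_i *: ('X^i * ('X + 1) ^+ (n - i.*2)).
Proof.
move=> gammaP ltnN; have [szg] := gammaP.
rewrite (@eval_ratfunE _ _ N); last first.
  exact: leq_trans szg ltnN.
rewrite [1 + 'X]addrC mulr_sumr => hE.
apply/eqP; rewrite -tofrac_eq; apply/eqP; rewrite hE rmorph_sum /=.
apply: eq_bigr => i _.
have [le_i|lt_i] := leqP (size gamma) i.
  by rewrite nth_default // scale0r polyC0 !rmorph0 mul0r mulr0.
have le_in := gamma_poly_double_le _ _ _ _ _ gammaP lt_i.
have nz : tofrac ('X + 1 : {poly R}) ^+ i.*2 != 0.
  by rewrite expf_neq0 // tofrac_eq0 addX1_neq0.
rewrite -mul_polyC !rmorphM -{1}(subnK le_in) exprD !rmorphXn /=.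
rewrite expr_div_n -exprM mul2n mulrCA; congr (_ * _).
by rewrite -mulrA [X in _ * X]mulrC divfK // mulrC.
Qed.

(** Makes powers of 1+X cancellable modulo powers of X: 0 is not a root of 1+X. *)
Lemma coprimep_XnaddX1 (R : fieldType) (m n : nat) :
  coprimep ('X^m : {poly R}) (('X + 1) ^+ n).
Proof.
apply/coprimep_expl/coprimep_expr.
have := coprimep_XsubC ('X + 1 : {poly R}) 0.
rewrite subr0 coprimep_sym => ->.
by rewrite /root !hornerE oner_neq0.
Qed.

Lemma dvdXn_coefP (R : fieldType) (m : nat) (p : {poly R}) :
  reflect (forall k, (k < m)%N -> p`_k = 0) ('X^m %| p).
Proof.
apply: (iffP idP) => [/dvdpP[q ->] k km|p0].
  by rewrite coefMXn km.
rewrite -[p](poly_take_drop m) dvdp_addl ?dvdp_mulIr //.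
suff -> : take_poly m p = 0 by rewrite dvdp0.
by apply/polyP => k; rewrite coef_take_poly coef0; case: ifP => // /p0.
Qed.

Lemma J_series_mul (R : fieldType) (n : nat) (h : {poly R}) (m : nat) :
  'X^m %| (\poly_(i < m) J_series n h i) * ('X + 1) ^+ n - h.
Proof.
(* [V] truncates the series inverse of (1+X)^n, which exists because the constant term is 1. *)
pose V : {poly R} := \poly_(i < m) fps_inv (fps_of_poly ((1 + 'X) ^+ n)) i.
have dV : 'X^m %| ('X + 1) ^+ n * V - 1.
  apply/dvdXn_coefP => k km; rewrite coefB coefM.
  have := @fps_mulV R (fps_of_poly ((1 + 'X) ^+ n)) k.
  rewrite {1}/fps_of_poly -horner_coef0 !hornerE expr1n oner_neq0.
  move=> /(_ isT); rewrite {3}/fps_of_poly => <-; apply/eqP.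
  rewrite subr_eq0 /fps_mul; apply/eqP; apply: eq_bigr => i _.
  by rewrite coef_poly (leq_ltn_trans (leq_subr _ _) km) /fps_of_poly addrC.
have dJ : 'X^m %| (\poly_(i < m) J_series n h i) - h * V.
  apply/dvdXn_coefP => k km; rewrite coefB coefM coef_poly km.
  apply/eqP; rewrite subr_eq0; apply/eqP; apply: eq_bigr => i _.
  by rewrite coef_poly (leq_ltn_trans (leq_subr _ _) km).
have -> : (\poly_(i < m) J_series n h i) * ('X + 1) ^+ n - h =
   ((\poly_(i < m) J_series n h i) - h * V) * ('X + 1) ^+ n
   + h * (('X + 1) ^+ n * V - 1) by ring.
by apply: dvdp_add; [apply: dvdp_mulr | apply: dvdp_mull].
Qed.

Lemma dvdXn_coefB (R : fieldType) (m k : nat) (p q : {poly R}) :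
  'X^m %| p - q -> (k < m)%N -> p`_k = q`_k.
Proof. by move=> /dvdXn_coefP pq km; apply/eqP; rewrite -subr_eq0 -coefB pq. Qed.

Lemma coef_addX1_exp (R : fieldType) (m k : nat) :
  (('X + 1 : {poly R}) ^+ m)`_k = 'C(m, k)%:R.
Proof.
have -> : ('X + 1 : {poly R}) ^+ m = \poly_(i < m.+1) 'C(m, i)%:R.
  rewrite exprD1n poly_def; apply: eq_bigr => i _.
  by rewrite scaler_nat.
by rewrite coef_poly ltnS; case: leqP => // lt_mk; rewrite bin_small.
Qed.

(** Pascal's rule splits the central coefficient into two terms that are equal by symmetry. *)
Lemma bin_double_central (m : nat) :
  (0 < m)%N -> 'C(m.*2, m) = ('C(m.*2.-1, m.-1)).*2.
Proof.
case: m => // m _; rewrite doubleS /= binS -[RHS]addnn; congr (_ + _)%N.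
have le_m : (m < m.*2.+1)%N by rewrite ltnS -addnn leq_addl.
by rewrite -(bin_sub le_m) subSS -addnn addnK.
Qed.

(** Product rule, moving the derivative onto the whole product; both terms then carry a factor r,
    one from [X^(r-1)] F' = r [X^r] F and the other from the exponent 2r. *)
Lemma coef_deriv_mul_exp (R : fieldType) (p : {poly R}) (r : nat) :
  (0 < r)%N ->
  (p^`() * ('X + 1) ^+ r.*2)`_r.-1 =
  r%:R * ((p * ('X + 1) ^+ r.*2)`_r - (p * ('X + 1) ^+ r.*2.-1)`_r.-1 *+ 2).
Proof.
move=> r0; have -> : p^`() * ('X + 1) ^+ r.*2 =
   (p * ('X + 1) ^+ r.*2)^`() - (p * ('X + 1) ^+ r.*2.-1) *+ r.*2.
  rewrite derivM deriv_exp derivD derivX derivC addr0 mul1r mulrnAr.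
  by rewrite addrK.
rewrite coefB coef_deriv coefMn prednK // -muln2 mulnC mulrnA mulrBr.
by rewrite !mulr_natl.
Qed.

(** Modulo X^(k+1), J is the sum of gamma_j X^j (1+X)^(-2j) over j <= k. The hypothesis [k.*2 <= e]
    keeps every exponent e - 2j nonnegative, so only polynomials occur. *)
Lemma coef_mul_addX1_exp (R : fieldType) (n k e : nat) (h gamma J : {poly R}) :
  is_gamma_poly n h gamma -> 'X^(k.+1) %| J * ('X + 1) ^+ n - h ->
  (k.*2 <= e)%N ->
  (J * ('X + 1) ^+ e)`_k = \sum_(j < k.+1) gamma`_j * 'C(e - j.*2, k - j)%:R.
Proof.
move=> gammaP JP ke.
pose G := \sum_(j < k.+1) gamma`_j *: ('X^j * ('X + 1) ^+ (e - j.*2)).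
have dG : 'X^(k.+1) %| J * ('X + 1) ^+ e - G.
  rewrite -(Gauss_dvdpl _ (coprimep_XnaddX1 R k.+1 n)).
  have -> : (J * ('X + 1) ^+ e - G) * ('X + 1) ^+ n =
    (J * ('X + 1) ^+ n - h) * ('X + 1) ^+ e
    + (h * ('X + 1) ^+ e - G * ('X + 1) ^+ n) by ring.
  rewrite dvdp_add ?dvdp_mulr //.
  (* This length covers all of [gamma] and splits at k+1; the tail is divisible by X^(k+1). *)
  have ltN : (n./2 < k.+1 + n./2.+1)%N by rewrite addnS ltnS leq_addl.
  rewrite (gamma_poly_expansion _ _ _ _ _ gammaP ltN) big_split_ord /= mulrDl.
  rewrite addrAC dvdp_add //; last first.
    rewrite dvdp_mulr //; apply: (big_ind (fun p => 'X^(k.+1) %| p)).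
    - exact: dvdp0.
    - by move=> p q; apply: dvdp_add.
    by move=> i _; rewrite -mul_polyC dvdp_mull // exprD -mulrA dvdp_mulr.
  suff -> : G * ('X + 1) ^+ n = (\sum_(i < k.+1) gamma`_i *:
      ('X^i * ('X + 1) ^+ (n - i.*2))) * ('X + 1) ^+ e by rewrite subrr dvdp0.
  rewrite /G !mulr_suml; apply: eq_bigr => i _.
  rewrite -!scalerAl -!mulrA -!exprD.
  (* Past the size of [gamma], [n - i.*2] may truncate to 0, but the coefficient vanishes. *)
  have [le_i|lt_i] := leqP (size gamma) i; first by rewrite nth_default ?scale0r.
  have le_ie : (i.*2 <= e)%N by rewrite (leq_trans _ ke) // leq_double -ltnS.
  have le_in := gamma_poly_double_le _ _ _ _ _ gammaP lt_i.
  by rewrite !addnBAC // [(e + n)%N]addnC.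
rewrite (dvdXn_coefB _ _ _ _ _ dG) // /G coef_sum; apply: eq_bigr => j _.
by rewrite coefZ coefXnM ltnNge -ltnS ltn_ord coef_addX1_exp.
Qed.

Theorem theorem1p7 (R : fieldType) (n : nat) (h gamma : {poly R})
    (h_recip : reciprocal n h) (h_gamma : is_gamma_poly n h gamma)
    (r : nat) (r_ge1 : (1 <= r)%N) :
  r%:R * gamma`_r =
    fps_mul (fps_deriv (J_series n h))
            (fps_of_poly (('X + 1) ^+ (2 * r))) r.-1.
Proof.
(* Precision r+1 is needed because the coefficient of index r-1 in the derivative involves the one
   of index r in the series. *)
pose J := \poly_(i < r.+1) J_series n h i.
have JP : 'X^(r.+1) %| J * ('X + 1) ^+ n - h by apply: J_series_mul.
have JP' : 'X^(r.-1.+1) %| J * ('X + 1) ^+ n - h.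
  by apply: dvdp_trans JP; rewrite prednK // dvdp_exp2l.
transitivity (J^`() * ('X + 1) ^+ r.*2)`_r.-1; last first.
  rewrite coefM mul2n; apply: eq_bigr => i _; rewrite coef_deriv coef_poly.
  by rewrite ltnS (leq_trans (ltn_ord i)) // prednK.
rewrite coef_deriv_mul_exp //; congr (_ * _).
rewrite (coef_mul_addX1_exp _ _ _ _ _ _ _ h_gamma JP) //.
rewrite (coef_mul_addX1_exp _ _ _ _ _ _ _ h_gamma JP'); last first.
  by rewrite -!subn1 doubleB leq_sub2l.
(* The term j = r of the first sum is gamma_r; the remaining terms j < r cancel in pairs against the
   second sum. *)
rewrite big_ord_recr /= !subnn bin0 mulr1 prednK // addrAC -sumrMnl.
rewrite -sumrB big1 ?add0r // => j _.
rewrite -doubleB bin_double_central ?subn_gt0 // -mulrnAr.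
rewrite -mul2n mulnC natrM mulr_natr.
(* Matches 2(r-j) - 1 with (2r-1) - 2j, and likewise the lower indices. *)
by rewrite doubleB -!subn1 !(subnAC _ 1%N) subrr.
Qed.
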